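(* Let $\kappa\ge0$ and let $A\in C^0(\mathbb{R},\mathrm{SL}(2,\mathbb{R}))\cap C^2(\mathbb{R},\mathbb{M}^2)$ be the solution of $\ddot A(t)+\kappa A(t)=\lambda(t)\,\mathrm{cof}\,A(t)$ with initial data $(A(0),\dot A(0))=(A_0,B_0)\in\mathcal{D}$ such that $$2X_1(A_0,B_0)+X_2(A_0,B_0)^2-X_3(A_0,B_0)^2=0.$$ If $\kappa=0$, then $A(t)=B_0t+A_0$, and if $\kappa>0$, then $$A(t)=(\cos\sqrt\kappa\,t)\,A_0+\tfrac1{\sqrt\kappa}(\sin\sqrt\kappa\,t)\,B_0 .$$
   Context: $\mathbb{M}^2$ is the space of real $2\times2$ matrices with inner product $\langle A,B\rangle=\mathrm{tr}(A^\top B)$ and norm $|A|=\langle A,A\rangle^{1/2}$. $\mathrm{SL}(2,\mathbb{R})=\{A:\det A=1\}$. $Z=\begin{bmatrix}0&-1\\1&0\end{bmatrix}$ and $\mathrm{cof}\,A=ZAZ^\top$ is the cofactor matrix. $\mathcal{D}=\{(A,B)\in\mathbb{M}^2\times\mathbb{M}^2:\det A=1,\ \langle B,\mathrm{cof}\,A\rangle=0\}$ is the tangent bundle of $\mathrm{SL}(2,\mathbb{R})$. $$X_1(A,B)=\tfrac12|B|^2+\tfrac{\kappa}{2}|A|^2,\quad X_2(A,B)=\tfrac12\langle ZA-AZ,B\rangle,\quad X_3(A,B)=\tfrac12\langle ZA+AZ,B\rangle.$$ A solution of $\ddot A+\kappa A=\lambda\,\mathrm{cof}\,A$ means that the equation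 holds for some $\lambda\in C^0(\mathbb{R},\mathbb{R})$; for an $\mathrm{SL}(2,\mathbb{R})$-valued solution necessarily $\lambda(t)=2(\kappa-\det\dot A(t))/|A(t)|^2$, and the solution with given initial data in $\mathcal{D}$ exists and is unique. *)

(* Defs.v *)
From HB Require Import structures.
From mathcomp Require Import all_boot all_order all_algebra.
From mathcomp Require Import all_classical all_reals all_analysis.

Set Implicit Arguments.
Unset Strict Implicit.
Unset Printing Implicit Defensive.

Import Order.TTheory GRing.Theory Num.Theory.
Import numFieldNormedType.Exports.

Local Open Scope classical_set_scope.
Local Open Scope ring_scope.

Section Matrices.
Variable R : realType.
Implicit Types A B : 'M[R]_2.

Definition mxip A B : R := \tr (A^T *m B).

(* The Euclidean norm; MathComp-Analysis's [`|A|] on matrices is the sup norm.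
   Both induce the same topology. *)
Definition mxnorm A : R := Num.sqrt (mxip A A).

Definition Zmx : 'M[R]_2 :=
  \matrix_(i < 2, j < 2) nth 0 (nth [::] [:: [:: 0; -1]; [:: 1; 0]] i) j.

Definition cof A : 'M[R]_2 := Zmx *m A *m Zmx^T.

Definition SL2 : set 'M[R]_2 := [set A | \det A = 1].

(* Tangent bundle of SL(2, R). *)
Definition TSL2 : set ('M[R]_2 * 'M[R]_2) :=
  [set P | \det P.1 = 1 /\ mxip P.2 (cof P.1) = 0].

Definition X1 (kappa : R) A B : R :=
  2^-1 * mxnorm B ^+ 2 + kappa / 2 * mxnorm A ^+ 2.

Definition X2 A B : R := 2^-1 * mxip (Zmx *m A - A *m Zmx) B.

Definition X3 A B : R := 2^-1 * mxip (Zmx *m A + A *m Zmx) B.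

(* [derive1] is a total function, so derivability is asserted separately. *)
Definition C2 (A : R -> 'M[R]_2) : Prop :=
  [/\ forall t : R, derivable A t 1,
      forall t : R, derivable (derive1 A) t 1
    & continuous (derive1n 2 A)].

Definition is_solution (kappa : R) (A : R -> 'M[R]_2) : Prop :=
  exists lambda : R -> R, continuous lambda /\
    forall t : R, derive1n 2 A t + kappa *: A t = lambda t *: cof (A t).

End Matrices.

(* Main.v *)
Require Import Defs.
From HB Require Import structures.
From mathcomp Require Import all_boot all_order all_algebra.
From mathcomp Require Import all_classical all_reals all_analysis.
From mathcomp Require Import ring lra.
Import Order.TTheory GRing.Theory Num.Theory.
Import numFieldNormedType.Exports.
Local Open Scope classical_set_scope.
Local Open Scope ring_scope.

(** Differentiating [\det A = 1] once gives [<A', cof A> = 0], so the curve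
    [(A, A')] stays in the tangent bundle; differentiating it twice and using
    [<A, cof A> = 2 \det A] and [<cof A, cof A> = |A|^2] gives
    [lambda |A|^2 = 2 (kappa - \det A')] (lemma [multiplier_eq]).

    The quantities [X1], [X2] and [X3] are constants of motion: the force
    [lambda cof A - kappa A] is orthogonal to [Z A] and [A Z], its [cof A]
    component is orthogonal to [A'], and its other component derives from the
    potential in [X1].  Hence [2 X1 + X2^2 - X3^2] is conserved (lemma
    [is_derive_energy]), and on the tangent bundle it equals
    [|A|^2 (kappa - \det B)] (lemma [energy_identity]).
    It vanishes at time 0, hence at all times; since [|A|^2 > 0] this forces
    [\det A' = kappa], hence [lambda = 0].  So every entry of [A] solves the
    linear equation [f'' + kappa f = 0], whose solutions are explicit. *)

(** * Matrix-valued functions: derivatives of products *)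

Lemma is_derive_mxP {R : realType} {m n : nat} (M : R -> 'M[R]_(m, n))
    (t : R) (dM : 'M[R]_(m, n)) :
  is_derive t 1 M dM <->
  (forall i j, is_derive t 1 (fun s => M s i j) (dM i j)).
Proof.
split=> [[dMt <-] i j|dMt].
  split; first by have /derivable_mxP := dMt; exact.
  by rewrite derive_mx// mxE.
have M_t : derivable M t 1 by apply/derivable_mxP => i j; have [] := dMt i j.
split=> //; apply/matrixP => i j; rewrite derive_mx// mxE.
by have [_] := dMt i j.
Qed.

Lemma is_derive_mulmx {R : realType} {m n p : nat} {M : R -> 'M[R]_(m, n)}
    {N : R -> 'M[R]_(n, p)} {t : R} {dM dN} :
  is_derive t 1 M dM -> is_derive t 1 N dN ->
  is_derive t 1 (fun s => M s *m N s) (dM *m N t + M t *m dN).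
Proof.
move=> /is_derive_mxP M' /is_derive_mxP N'; apply/is_derive_mxP => i j.
have -> : (fun s => (M s *m N s) i j) =
    \sum_(k < n) ((fun s => M s i k) * (fun s => N s k j)).
  by apply/funext => s; rewrite mxE fct_sumE.
have H k : is_derive t 1 ((fun s => M s i k) * (fun s => N s k j)) _ :=
  is_deriveM (M' i k) (N' k j).
apply: is_derive_eq; rewrite !mxE -big_split/=.
by apply: eq_bigr => k _; rewrite /GRing.scale/= addrC [_ * dM _ _]mulrC.
Qed.

Lemma is_derive_mxip {R : realType} {M N : R -> 'M[R]_2} {t : R} {dM dN} :
  is_derive t 1 M dM -> is_derive t 1 N dN ->
  is_derive t 1 (fun s => mxip (M s) (N s)) (mxip dM (N t) + mxip (M t) dN).
Proof.
move=> M' N'.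
have MT' : is_derive t 1 (fun s => (M s)^T) dM^T.
  apply/is_derive_mxP => i j; rewrite mxE.
  under eq_fun do rewrite mxE.
  by have /is_derive_mxP := M'; exact.
have /is_derive_mxP P' := is_derive_mulmx MT' N'.
rewrite /mxip -mxtraceD /mxtrace.
have -> : (fun s => \sum_i ((M s)^T *m N s) i i) =
    \sum_i (fun s => ((M s)^T *m N s) i i).
  by apply/funext => s; rewrite fct_sumE.
exact: is_derive_sum.
Qed.

Lemma is_derive_cof {R : realType} {M : R -> 'M[R]_2} {t : R} {dM} :
  is_derive t 1 M dM -> is_derive t 1 (fun s => cof (M s)) (cof dM).
Proof.
move=> M'; have Z' (C : 'M[R]_2) : is_derive t 1 (cst C) 0.
  exact: is_derive_cst.
apply: is_derive_eq.
  exact: (is_derive_mulmx (is_derive_mulmx (Z' (Zmx R)) M') (Z' (Zmx R)^T)).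
by rewrite mul0mx add0r mulmx0 addr0.
Qed.

(** * Two-by-two matrices in coordinates *)

Lemma mulmx2E {R : realType} (A B : 'M[R]_2) i j :
  (A *m B) i j = A i 0 * B 0 j + A i 1 * B 1 j.
Proof.
by rewrite mxE !big_ord_recl big_ord0 addr0; congr (_ * _ + _ * _); f_equal;
  apply/val_inj.
Qed.

Lemma mxipE {R : realType} (A B : 'M[R]_2) :
  mxip A B = A 0 0 * B 0 0 + A 0 1 * B 0 1 + A 1 0 * B 1 0 + A 1 1 * B 1 1.
Proof.
rewrite /mxip /mxtrace !big_ord_recl big_ord0 addr0.
have -> : lift ord0 ord0 = 1 :> 'I_2 by apply/val_inj.
by rewrite !mulmx2E !mxE; ring.
Qed.

Lemma det2E {R : realType} (A : 'M[R]_2) :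
  \det A = A 0 0 * A 1 1 - A 0 1 * A 1 0.
Proof.
rewrite (expand_det_row _ ord0) !big_ord_recl big_ord0 addr0 /cofactor.
rewrite !det_mx11 !mxE/= expr0 expr1 mul1r mulN1r mulrN.
by congr (A _ _ * A _ _ - A _ _ * A _ _); apply/val_inj.
Qed.

Lemma ZmxE {R : realType} :
  [/\ Zmx R 0 0 = 0, Zmx R 0 1 = -1, Zmx R 1 0 = 1 & Zmx R 1 1 = 0].
Proof. by rewrite !mxE. Qed.

Lemma cofE {R : realType} (A : 'M[R]_2) :
  [/\ cof A 0 0 = A 1 1, cof A 0 1 = - A 1 0, cof A 1 0 = - A 0 1 &
      cof A 1 1 = A 0 0].
Proof.
have [Z00 Z01 Z10 Z11] := @ZmxE R.
by rewrite /cof !mulmx2E ![(Zmx R)^T _ _]mxE Z00 Z01 Z10 Z11; split; ring.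
Qed.

Lemma det_mxip_cof {R : realType} (A : 'M[R]_2) : mxip A (cof A) = 2 * \det A.
Proof. by rewrite mxipE det2E; have [-> -> -> ->] := cofE A; ring. Qed.

Lemma mxip_cofC {R : realType} (A B : 'M[R]_2) :
  mxip A (cof B) = mxip B (cof A).
Proof.
rewrite !mxipE; have [-> -> -> ->] := cofE A.
by have [-> -> -> ->] := cofE B; ring.
Qed.

Lemma mxip_cof_cof {R : realType} (A : 'M[R]_2) :
  mxip (cof A) (cof A) = mxip A A.
Proof. by rewrite !mxipE; have [-> -> -> ->] := cofE A; ring. Qed.

Lemma mxipC {R : realType} (A B : 'M[R]_2) : mxip A B = mxip B A.
Proof. by rewrite !mxipE; ring. Qed.

Lemma mxipBZl {R : realType} (a b : R) (A B C : 'M[R]_2) :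
  mxip (a *: A - b *: B) C = a * mxip A C - b * mxip B C.
Proof. by rewrite !mxipE !mxE; ring. Qed.

Lemma mxipBZr {R : realType} (a b : R) (A B C : 'M[R]_2) :
  mxip C (a *: A - b *: B) = a * mxip C A - b * mxip C B.
Proof. by rewrite ![mxip C _]mxipC mxipBZl. Qed.

(** [Z A] and [A Z] are orthogonal to [A], because [Z] is antisymmetric. *)
Lemma mxip_rot {R : realType} (A : 'M[R]_2) :
  mxip (Zmx R *m A) A = 0 /\ mxip (A *m Zmx R) A = 0.
Proof.
have [Z00 Z01 Z10 Z11] := @ZmxE R.
by rewrite !mxipE !mulmx2E Z00 Z01 Z10 Z11; split; ring.
Qed.

(** They are tangent to the level set of the determinant, the orbits of [A]
    under left and right rotations. *)
Lemma mxip_rot_cof {R : realType} (A : 'M[R]_2) :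
  mxip (Zmx R *m A) (cof A) = 0 /\ mxip (A *m Zmx R) (cof A) = 0.
Proof.
have [Z00 Z01 Z10 Z11] := @ZmxE R.
rewrite !mxipE; have [-> -> -> ->] := cofE A.
by rewrite !mulmx2E Z00 Z01 Z10 Z11; split; ring.
Qed.

Lemma mxnorm_sqr {R : realType} (A : 'M[R]_2) : mxnorm A ^+ 2 = mxip A A.
Proof.
by rewrite /mxnorm sqr_sqrtr// mxipE -!expr2 !addr_ge0// sqr_ge0.
Qed.

Lemma mxip_SL2_gt0 {R : realType} {A : 'M[R]_2} : SL2 A -> 0 < mxip A A.
Proof.
rewrite /SL2 /= det2E mxipE => detA.
(* [2 \det A <= |A|^2] by completing two squares *)
have := sqr_ge0 (A 0 0 - A 1 1); have := sqr_ge0 (A 0 1 + A 1 0).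
nra.
Qed.

(** [X3 + X2] and [X3 - X2] are the momenta of left and right rotation. *)
Lemma X3DX2 {R : realType} (A B : 'M[R]_2) :
  X3 A B + X2 A B = mxip (Zmx R *m A) B.
Proof.
rewrite /X2 /X3; set ZA := _ *m A; set AZ := A *m _.
by rewrite !mxipE !mxE; field.
Qed.

Lemma X3BX2 {R : realType} (A B : 'M[R]_2) :
  X3 A B - X2 A B = mxip (A *m Zmx R) B.
Proof.
rewrite /X2 /X3; set ZA := _ *m A; set AZ := A *m _.
by rewrite !mxipE !mxE; field.
Qed.

(** The conserved combination [2 X1 + X2^2 - X3^2], with [X2^2 - X3^2] factored
    so that only inner products occur. *)
Definition energy {R : realType} (kappa : R) (A B : 'M[R]_2) : R :=
  mxip B B + kappa * mxip A A - mxip (Zmx R *m A) B * mxip (A *m Zmx R) B.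

Lemma energyE {R : realType} (kappa : R) (A B : 'M[R]_2) :
  2 * X1 kappa A B + X2 A B ^+ 2 - X3 A B ^+ 2 = energy kappa A B.
Proof.
rewrite /energy -X3DX2 -X3BX2 /X1 !mxnorm_sqr.
by set x := X2 _ _; set y := X3 _ _; field.
Qed.

Lemma energy_identity {R : realType} (kappa : R) (A B : 'M[R]_2) :
  TSL2 (A, B) -> energy kappa A B = mxip A A * (kappa - \det B).
Proof.
move=> -[/= detA tgt]; apply/eqP; rewrite -subr_eq0.
(* In general the difference lies in the ideal generated by the two equations
   defining the tangent bundle. *)
have -> : energy kappa A B - mxip A A * (kappa - \det B) =
    mxip B (cof A) * mxip A B + mxip B B * (1 - \det A).
  rewrite /energy !mxipE !det2E; have [-> -> -> ->] := cofE A.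
  by rewrite !mulmx2E; have [-> -> -> ->] := @ZmxE R; ring.
by rewrite detA tgt subrr mul0r mulr0 addr0.
Qed.

(** * The harmonic oscillator *)

Lemma is_derive_0_affine {R : realType} {f g : R -> R} :
  (forall t : R, is_derive t 1 f (g t)) -> (forall t : R, is_derive t 1 g 0) ->
  forall t, f t = t * g 0 + f 0.
Proof.
move=> f' g' t; have gE s : g s = g 0 by exact: is_derive_0_is_cst.
have h' (s : R) : is_derive s 1 (f - (g 0 \*: id)) 0.
  have f's := f' s; apply: is_derive_eq.
  by rewrite gE /GRing.scale/= mulr1 subrr.
have : f t - g 0 * t = f 0 - g 0 * 0 := is_derive_0_is_cst t 0 h'.
by rewrite mulr0 subr0 => <-; ring.
Qed.

Lemma oscillator_sol {R : realType} {w : R} {f g : R -> R} : w != 0 ->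
  (forall t : R, is_derive t 1 f (g t)) ->
  (forall t : R, is_derive t 1 g (- w ^+ 2 * f t)) ->
  forall t, f t = cos (w * t) * f 0 + w^-1 * sin (w * t) * g 0.
Proof.
move=> w0 f' g' t.
pose c : R -> R := cos \o (w \*: id); pose s : R -> R := sin \o (w \*: id).
have cE (x : R) : c x = cos (w * x) by [].
have sE (x : R) : s x = sin (w * x) by [].
have lin' (x : R) : is_derive x 1 (w \*: id) (w : R).
  by apply: is_derive_eq; rewrite /GRing.scale/= mulr1.
have c' (x : R) : is_derive x 1 c (- s x * w) by exact: is_derive1_comp.
have s' (x : R) : is_derive x 1 s (c x * w) by exact: is_derive1_comp.
(* The phase vector [(f, g / w)], rotated back by the angle [w t], is
   constant. *)
have u' (x : R) : is_derive x 1 (w \*: (f * c) - g * s) 0.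
  have := (f' x, g' x, c' x, s' x) => -[[[? ?] ?] ?].
  by apply: is_derive_eq; rewrite /GRing.scale/=; ring.
have v' (x : R) : is_derive x 1 (w \*: (f * s) + g * c) 0.
  have := (f' x, g' x, c' x, s' x) => -[[[? ?] ?] ?].
  by apply: is_derive_eq; rewrite /GRing.scale/=; ring.
have : w * (f t * s t) + g t * c t = w * (f 0 * s 0) + g 0 * c 0 :=
  is_derive_0_is_cst t 0 v'.
have : w * (f t * c t) - g t * s t = w * (f 0 * c 0) - g 0 * s 0 :=
  is_derive_0_is_cst t 0 u'.
rewrite !cE !sE mulr0 cos0 sin0 !mulr1 !mulr0 add0r subr0 => u0 v0.
have cs := cos2Dsin2 (w * t).
apply: (mulfI w0); rewrite mulrDr !mulrA divff// mul1r -v0.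
transitivity ((w * (f t * cos (w * t)) - g t * sin (w * t)) * cos (w * t)
   + sin (w * t) * (w * (f t * sin (w * t)) + g t * cos (w * t))).
  transitivity (w * f t * (cos (w * t) ^+ 2 + sin (w * t) ^+ 2)).
    by rewrite cs mulr1.
  by ring.
by rewrite u0; ring.
Qed.

(** * Motion on the special linear group *)

Lemma SL2_curve_tangent {R : realType} {A B : R -> 'M[R]_2} :
  (forall t, SL2 (A t)) -> (forall t : R, is_derive t 1 A (B t)) ->
  forall t, TSL2 (A t, B t).
Proof.
move=> ASL A' t; split; first exact: ASL.
have := is_derive_mxip (A' t) (is_derive_cof (A' t)).
rewrite (mxip_cofC (A t)) -mulr2n -mulr_natl.
have -> : (fun s => mxip (A s) (cof (A s))) = cst 2.
  by apply/funext => s; rewrite det_mxip_cof ASL mulr1.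
move=> [_]; rewrite derive_cst => /esym/eqP.
by rewrite mulf_eq0 pnatr_eq0/= => /eqP.
Qed.

Lemma multiplier_eq {R : realType} {kappa l t : R} {A B : R -> 'M[R]_2} :
  (forall t, SL2 (A t)) -> (forall t : R, is_derive t 1 A (B t)) ->
  is_derive t 1 B (l *: cof (A t) - kappa *: A t) ->
  l * mxip (A t) (A t) = 2 * (kappa - \det (B t)).
Proof.
move=> ASL A' B'.
have := is_derive_mxip B' (is_derive_cof (A' t)).
have -> : (fun s => mxip (B s) (cof (A s))) = cst 0.
  by apply/funext => s; case: (SL2_curve_tangent ASL A' s).
move=> [_]; rewrite derive_cst det_mxip_cof.
have detA : \det (A t) = 1 := ASL t.
rewrite mxipBZl mxip_cof_cof det_mxip_cof detA => e0.
by apply: subr0_eq; rewrite [RHS]e0; ring.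
Qed.

Lemma is_derive_energy {R : realType} {kappa l t : R} {A B : R -> 'M[R]_2} :
  is_derive t 1 A (B t) -> is_derive t 1 B (l *: cof (A t) - kappa *: A t) ->
  mxip (B t) (cof (A t)) = 0 ->
  is_derive t 1 (fun s => energy kappa (A s) (B s)) 0.
Proof.
move=> A' B' tgt.
have Z' : is_derive t 1 (cst (Zmx R)) 0 by exact: is_derive_cst.
have ZA' := is_derive_mxip (is_derive_mulmx Z' A') B'.
have AZ' := is_derive_mxip (is_derive_mulmx A' Z') B'.
have AA' := is_derive_mxip A' A'; have BB' := is_derive_mxip B' B'.
have E' := is_deriveB (is_deriveD BB' (is_deriveZ kappa AA'))
  (is_deriveM ZA' AZ').
apply: (is_derive_eq E').
rewrite mul0mx mulmx0 add0r addr0 mxipBZl !mxipBZr /GRing.scale/=.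
(* The force exerts no torque, its [cof A] component does no work, and its
   [A] component is balanced by the potential [kappa |A|^2]. *)
have [-> ->] := mxip_rot (B t); have [-> ->] := mxip_rot (A t).
have [-> ->] := mxip_rot_cof (A t).
rewrite [mxip (cof _) (B t)]mxipC tgt [mxip (B t) (A t)]mxipC.
by ring.
Qed.

(** On the zero level of the conserved combination the constraint force
    vanishes. *)
Lemma multiplier_eq0 {R : realType} {kappa : R} {l : R -> R}
    {A B : R -> 'M[R]_2} :
  (forall t, SL2 (A t)) -> (forall t : R, is_derive t 1 A (B t)) ->
  (forall t : R, is_derive t 1 B (l t *: cof (A t) - kappa *: A t)) ->
  energy kappa (A 0) (B 0) = 0 -> forall t, l t = 0.
Proof.
move=> ASL A' B' E0 t.
have tgt s := SL2_curve_tangent ASL A' s.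
have E' s := is_derive_energy (A' s) (B' s) (proj2 (tgt s)).
have : energy kappa (A t) (B t) = energy kappa (A 0) (B 0) :=
  is_derive_0_is_cst t 0 E'.
have A_gt0 := mxip_SL2_gt0 (ASL t).
rewrite E0 energy_identity// => /eqP; rewrite mulf_eq0 gt_eqF//= => /eqP detB.
have := multiplier_eq ASL A' (B' t); rewrite detB mulr0 => /eqP.
by rewrite mulf_eq0 (gt_eqF A_gt0) orbF => /eqP.
Qed.

Theorem lemma9p4 (R : realType) (kappa : R) (hkappa : 0 <= kappa)
  (A0 B0 : 'M[R]_2) (h0 : TSL2 (A0, B0))
  (A : R -> 'M[R]_2)
  (hA0 : continuous A) (hASL : forall t : R, SL2 (A t)) (hA2 : C2 A)
  (hsol : is_solution kappa A)
  (hinitA : A 0 = A0) (hinitB : derive1 A 0 = B0)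
  (hX : 2 * X1 kappa A0 B0 + X2 A0 B0 ^+ 2 - X3 A0 B0 ^+ 2 = 0) :
  (kappa = 0 -> forall t : R, A t = t *: B0 + A0) /\
  (0 < kappa -> forall t : R,
     A t = cos (Num.sqrt kappa * t) *: A0
           + ((Num.sqrt kappa)^-1 * sin (Num.sqrt kappa * t)) *: B0).
Proof.
case: hA2 => dA ddA _; case: hsol => l [_ eqA].
have A' (t : R) : is_derive t 1 A (derive1 A t).
  by split; [exact: dA | rewrite derive1E].
have lB' (t : R) : is_derive t 1 (derive1 A) (l t *: cof (A t) - kappa *: A t).
  split; first exact: ddA.
  by rewrite -derive1E -eqA addrK.
have l0 t : l t = 0.
  apply: (multiplier_eq0 hASL A' lB').
  by rewrite hinitA hinitB -energyE.
have B' (t : R) : is_derive t 1 (derive1 A) (- kappa *: A t).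
  by have := lB' t; rewrite l0 scale0r sub0r scaleNr.
have Aij' i j (t : R) : is_derive t 1 (fun s => A s i j) (derive1 A t i j).
  by have /is_derive_mxP := A' t; exact.
have Bij' i j (t : R) :
    is_derive t 1 (fun s => derive1 A s i j) (- kappa * A t i j).
  by have /is_derive_mxP/(_ i j) := B' t; rewrite mxE.
split=> [kappa0 t|kappa_gt0 t]; apply/matrixP => i j;
  rewrite !mxE -hinitA -hinitB.
  apply: (is_derive_0_affine (Aij' i j)) => s.
  by have := Bij' i j s; rewrite kappa0 oppr0 mul0r.
apply: (oscillator_sol _ (Aij' i j)) => [|s].
  by rewrite gt_eqF// sqrtr_gt0.
by rewrite sqr_sqrtr.
Qed.
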